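(* Let $n\ge 2$ and let $c$ be an integer with $c\ge\lceil\log_2 n\rceil$. (a) For every integer $\omega$, every $n$-periodic binary sequence $\mathbf{s}_n^{\infty}$ in $\mathcal{P}(n,\omega)$, where $\lceil\log_2 n\rceil\le c\le\min\{\omega,\lfloor n/2\rfloor+1\}$, there exists an integer $k$ such that $L^k(\mathbf{s}_n)\in\mathcal{B}(n,c)$. (b) Furthermore, for every $c$ with $\lceil\log_2 n\rceil\le c\le\min\{n-1,\lfloor n/2\rfloor+1\}$, $$\bigcup_{\omega=c}^{n-1}\mathcal{P}(n,\omega)=\left\{(L^{k}(\mathbf{s}_n))^{\infty}\;:\;\mathbf{s}_n\in\mathcal{B}(n,c),\ 0\le k<n\right\}.$$
   Context: All sequences are binary (over $\mathbb{Z}_2=\{0,1\}$). A finite sequence $\mathbf{s}_n=(s_0,\dots,s_{n-1})$ is aperiodic if it is not of the form $(s_0,\dots,s_{k-1})^{n/k}$ (concatenation of $n/k$ copies) for a proper divisor $k$ of $n$. $\mathbf{s}_n^{\infty}$ is the infinite repetition of $\mathbf{s}_n$; an $n$-periodic sequence is one of the form $\mathbf{s}_n^\infty$ with $\mathbf{s}_n$ aperiodic (least period $n$). Left circular shift: $L(\mathbf{s}_n)=(s_1,\dots,s_{n-1},s_0)$, and $L^k$ is its $k$-fold iterate. Nonlinear complexity: $nlc(\mathbf{s})$ of a finite or infinite sequence is the length of the shortest feedback shift register generating it, i.e. the least $m\ge 0$ such that there is a function $f:\mathbb{Z}_2^m\to\mathbb{Z}_2$ with $s_{i+m}=f(s_i,\dots,s_{i+m-1})$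 for all $i\ge0$ for which $s_{i+m}$ is defined. $\mathcal{P}(n,\omega)$ is the set of $n$-periodic binary sequences with nonlinear complexity $\omega$. For $1\le c<n$ and $1\le d\le\min\{n-c,\lfloor n/2\rfloor\}$, $\mathcal{B}(n,c,d)$ is the set of aperiodic binary sequences $\mathbf{s}_n$ such that $(s_0,\dots,s_{d-1})$ is aperiodic, $s_i=s_{i+d}$ for $0\le i\le c-2$, and $s_{c-1}\ne s_{c+d-1}$ (the remaining terms $s_{c+d},\dots,s_{n-1}$ being arbitrary subject to $\mathbf{s}_n$ being aperiodic). $\mathcal{B}(n,c)=\bigcup_{d=1}^{\min\{n-c,\lfloor n/2\rfloor\}}\mathcal{B}(n,c,d)$. *)

(* Defs.v *)
(* Binary sequences: Z_2 is represented by bool. *)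
From mathcomp Require Import all_boot.
From mathcomp Require Import boolp classical_sets.

Local Open Scope classical_set_scope.

(* For nonempty s, the hypotheses force 0 < k. *)
Definition aperiodic (s : seq bool) : Prop :=
  forall k, k %| size s -> k < size s ->
    s <> flatten (nseq (size s %/ k) (take k s)).

(* The infinite repetition of s, for nonempty s. *)
Definition infrep (s : seq bool) : nat -> bool :=
  fun i => nth false s (i %% size s).

Definition Lshift {n : nat} (s : n.-tuple bool) : n.-tuple bool := [tuple of rot 1 s].

Definition FSR_generates {m : nat} (f : m.-tuple bool -> bool) (u : nat -> bool) : Prop :=
  forall i, u (i + m) = f [tuple u (i + j) | j < m].

(* Nonlinear complexity as a relation: an infinite sequence that is not
   eventually periodic is generated by no feedback shift register and has no
   complexity. *)
Definition nlc_is (u : nat -> bool) (w : nat) : Prop :=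
  (exists f : w.-tuple bool -> bool, FSR_generates f u) /\
  (forall m (f : m.-tuple bool -> bool), FSR_generates f u -> w <= m).

Definition Pset (n w : nat) : set (nat -> bool) :=
  [set infrep s | s in [set s : n.-tuple bool | aperiodic s]] `&`
  [set u | nlc_is u w].

(* Meant for 1 <= c < n and 1 <= d <= minn (n - c) n./2. The range i < c.-1 is
   0 <= i <= c - 2, empty when c = 1. *)
Definition Bset_d (n c d : nat) : set (n.-tuple bool) :=
  [set s | [/\ aperiodic s,
               aperiodic (take d s),
               forall i, i < c.-1 -> nth false s i = nth false s (i + d)
             & nth false s c.-1 <> nth false s (c + d).-1]].

(* minn (n - c) n./2 is 0, hence the union empty, when n <= c. *)
Definition Bset (n c : nat) : set (n.-tuple bool) :=
  \bigcup_(d in [set d | 1 <= d <= minn (n - c) n./2]) Bset_d n c d.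

(* Main.v *)
(* An infinite sequence u has complexity at least c exactly when two of its
   windows of length c - 1 agree while their successors differ.  For an
   n-periodic u the distance d of such windows can be reduced modulo n and, by
   exchanging their roles, made at most n/2; the rotation of the period starting
   at the first window is then a candidate for B(n, c, d).  Taking d minimal
   makes the prefix of length d aperiodic: if it had a proper period k dividing
   d, so would the prefix of length c + d - 1, and the windows starting at d - k
   and at d would be a conflict at the smaller distance k.  Conversely the
   complexity is at most n - 1, because n - 1 consecutive terms determine the
   next one through the parity of a full period. *)
Require Import Defs.
From mathcomp Require Import all_boot.
From mathcomp Require Import boolp classical_sets.
From mathcomp Require Import zify.

Local Open Scope classical_set_scope.

(** * Aperiodic words, their infinite repetitions and rotations *)

Lemma nth_flatten_nseq (T : Type) (x0 : T) (t : seq T) q i :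
  i < q * size t -> nth x0 (flatten (nseq q t)) i = nth x0 t (i %% size t).
Proof.
elim: q i => [|q IHq] i //=; rewrite mulSn nth_cat => lti.
case: ltnP => [lt_it|le_ti]; first by rewrite modn_small.
rewrite IHq; last by lia.
by rewrite -{2}(subnK le_ti) modnDr.
Qed.

Lemma aperiodicP (s : seq bool) :
  aperiodic s <->
  forall k, k %| size s -> k < size s ->
    ~ forall i, i < size s -> nth false s i = nth false s (i %% k).
Proof.
have eq_rep k : k %| size s -> k < size s ->
    s = flatten (nseq (size s %/ k) (take k s)) <->
    forall i, i < size s -> nth false s i = nth false s (i %% k).
  move=> dvd_k lt_k; have k_gt0 : 0 < k.
    by case: k dvd_k lt_k => //; rewrite dvd0n => /eqP->.
  have sz_take : size (take k s) = k by rewrite size_takel // ltnW.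
  have nth_rep i : i < size s ->
      nth false (flatten (nseq (size s %/ k) (take k s))) i =
      nth false s (i %% k).
    move=> lti; rewrite nth_flatten_nseq sz_take ?divnK //.
    by rewrite nth_take ?ltn_mod.
  split=> [def_s i lti|per]; first by rewrite {1}def_s nth_rep.
  apply: (@eq_from_nth _ false) => [|i lti]; last by rewrite nth_rep // per.
  by rewrite size_flatten /shape map_nseq sz_take sumn_nseq mulnC divnK.
split=> ap k dvd_k lt_k; first by move/(eq_rep k dvd_k lt_k); apply: ap.
by move/(eq_rep k dvd_k lt_k); apply: ap.
Qed.

Lemma infrep_period n (s : n.-tuple bool) i : infrep s (i + n) = infrep s i.
Proof. by rewrite /infrep size_tuple modnDr. Qed.

Lemma period_mul (u : nat -> bool) k :
  (forall i, u (i + k) = u i) -> forall q i, u (i + q * k) = u i.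
Proof.
by move=> per; elim=> [|q IHq] i; rewrite ?addn0 // mulSn addnA IHq per.
Qed.

Lemma period_modn (u : nat -> bool) k :
  (forall i, u (i + k) = u i) -> forall i, u (i %% k) = u i.
Proof.
by move=> per i; rewrite {2}(divn_eq i k) addnC (period_mul _ _ per).
Qed.

(** Periods of the infinite repetition do not depend on the starting point, so in this form
    aperiodicity passes to rotations. *)
Lemma aperiodic_infrepP (s : seq bool) :
  aperiodic s <->
  forall k, k %| size s -> k < size s -> ~ forall i, infrep s (i + k) = infrep s i.
Proof.
have eq_per k : k %| size s -> k < size s ->
    (forall i, i < size s -> nth false s i = nth false s (i %% k)) <->
    (forall i, infrep s (i + k) = infrep s i).
  move=> dvd_k lt_k; have s_gt0 : 0 < size s by lia.
  split=> [per i|per i lti].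
    by rewrite /infrep per ?ltn_mod // [RHS]per ?ltn_mod // !modn_dvdm // modnDr.
  have := period_modn _ _ per i; rewrite /infrep [i %% size s]modn_small //.
  by rewrite modn_small // (leq_ltn_trans (leq_mod _ _)).
rewrite aperiodicP; split=> ap k dvd_k lt_k.
  by move/(eq_per k dvd_k lt_k); apply: ap.
by move/(eq_per k dvd_k lt_k); apply: ap.
Qed.

Lemma infrep_Lshift n (s : n.-tuple bool) k i :
  0 < n -> infrep (iter k Lshift s) i = infrep s (i + k).
Proof.
move=> n_gt0; elim: k i => [|k IHk] i; first by rewrite addn0.
rewrite iterS addnS -addSn -IHk; set t := iter k _ s.
rewrite /infrep !size_tuple /= /rot nth_cat size_drop size_tuple.
have := ltn_pmod i n_gt0; set r := i %% n => lt_r.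
have -> : i.+1 %% n = r.+1 %% n by rewrite -addn1 -modnDml addn1.
case: ltnP => r_n; first by rewrite nth_drop add1n modn_small //; lia.
have -> : r = n.-1 by lia.
by rewrite prednK // modnn subn1 subnn nth_take.
Qed.

Lemma aperiodic_Lshift n (s : n.-tuple bool) k :
  0 < n -> aperiodic s -> aperiodic (iter k Lshift s).
Proof.
move=> n_gt0 /aperiodic_infrepP; rewrite size_tuple => ap.
apply/aperiodic_infrepP; rewrite size_tuple => p dvd_p lt_p per.
apply: (ap p dvd_p lt_p) => i.
(* Adding [k * n] makes the index at least [k], so it can be read as a term of the rotated
   sequence. *)
rewrite -(period_mul _ _ (infrep_period n s) k).
rewrite -[RHS](period_mul _ _ (infrep_period n s) k).
have -> : i + p + k * n = i + k * n.-1 + p + k by nia.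
have -> : i + k * n = i + k * n.-1 + k by nia.
by rewrite -!(infrep_Lshift n s k) // per.
Qed.

(** Membership of [infrep s] in [Pset] only provides some aperiodic word with this repetition;
    injectivity identifies it with [s]. *)
Lemma infrep_inj n (s t : n.-tuple bool) : infrep s = infrep t -> s = t.
Proof.
move=> eq_st; apply/val_inj/(@eq_from_nth _ false); first by rewrite !size_tuple.
move=> i; rewrite size_tuple => lt_i.
by have /(congr1 (@^~ i)) := eq_st; rewrite /infrep !size_tuple modn_small.
Qed.

(** * Conflicts and nonlinear complexity *)

Definition conflict (u : nat -> bool) (m i j : nat) : Prop :=
  (forall k, k < m -> u (i + k) = u (j + k)) /\ u (i + m) <> u (j + m).

Lemma FSR_conflictP (u : nat -> bool) m :
  (exists f : m.-tuple bool -> bool, FSR_generates f u) <->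
  ~ exists i j, conflict u m i j.
Proof.
split=> [[f gen] [i [j [eq_win]]]|noconf].
  rewrite !gen; apply; congr f; apply: eq_from_tnth => k.
  by rewrite !tnth_mktuple eq_win.
(* The feedback is 1 on a window when some occurrence of it is followed by 1; without conflicts all
   occurrences have the same successor. *)
exists (fun t => `[< exists i, [tuple u (i + k) | k < m] = t /\ u (i + m) >]).
move=> i; apply/idP/asboolP => [um|[j [/(congr1 (@tnth _ _)) eq_win um]]].
  by exists i.
apply: contra_notT noconf => not_um; exists i, j; split=> [k lt_k|].
  have := congr1 (@^~ (Ordinal lt_k)) eq_win.
  by rewrite !tnth_mktuple.
by rewrite um; apply/negP.
Qed.

(** In a conflict of longer windows, the last [m] terms of each window already form a conflict. *)
Lemma FSR_widen (u : nat -> bool) m m' :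
  m <= m' ->
  (exists f : m.-tuple bool -> bool, FSR_generates f u) ->
  exists f : m'.-tuple bool -> bool, FSR_generates f u.
Proof.
move=> le_m; rewrite !FSR_conflictP => noconf [i [j [eq_win ne]]].
apply: noconf; exists (i + (m' - m)), (j + (m' - m)); split=> [k lt_k|].
  by rewrite -!addnA; apply: eq_win; lia.
by rewrite -!addnA subnK.
Qed.

Lemma FSR_period (u : nat -> bool) n :
  0 < n -> (forall i, u (i + n) = u i) ->
  exists f : n.-1.-tuple bool -> bool, FSR_generates f u.
Proof.
move=> n_gt0 per.
have parity i : \big[addb/false]_(k < n) u (i + k) =
                \big[addb/false]_(k < n) u k.
  elim: i => [|i <-]; first by apply: eq_bigr => k _; rewrite add0n.
  case: n n_gt0 per => // n _ per; rewrite big_ord_recr big_ord_recl /=.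
  rewrite addbC addn0 addSnnS per; congr addb.
  by apply: eq_bigr => k _; rewrite addSnnS.
apply/FSR_conflictP => -[i [j [eq_win]]]; apply.
(* Two sums of [n] terms are equal and agree in all terms but the last, so the last terms cancel to
   equality in Z_2. *)
have := parity i; rewrite -(parity j); case: n n_gt0 {per parity} eq_win => //= n _.
move=> eq_win; rewrite !big_ord_recr /=.
rewrite (eq_bigr (fun k : 'I_n => u (j + k))) => [|k _]; last exact: eq_win.
exact: addbI.
Qed.

Lemma nlc_exists (u : nat -> bool) m :
  (exists f : m.-tuple bool -> bool, FSR_generates f u) ->
  exists2 w, w <= m & nlc_is u w.
Proof.
move=> gen_m; pose gen w := `[< exists f : w.-tuple bool -> bool, FSR_generates f u >].
have ex_gen : exists w, gen w by exists m; apply/asboolP.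
case: (ex_minnP ex_gen) => w /asboolP gen_w min_w; exists w.
  by apply: min_w; apply/asboolP.
by split=> // p f gen_f; apply: min_w; apply/asboolP; exists f.
Qed.

(** Generating lengths are upward closed, so [m < w] says that no register of length [m] generates
    [u]. *)
Lemma nlc_ge (u : nat -> bool) m w :
  nlc_is u w -> (m < w <-> exists i j, conflict u m i j).
Proof.
move=> [gen_w min_w]; split=> [lt_mw|conf].
  apply: contrapT => /FSR_conflictP[f gen_f].
  by have := min_w _ f gen_f; lia.
rewrite ltnNge; apply/negP => le_wm.
by have /FSR_conflictP := FSR_widen _ _ _ le_wm gen_w.
Qed.

(** * From conflicts to members of B(n, c) and back *)

Lemma conflict_half (u : nat -> bool) n m :
  0 < n -> (forall i, u (i + n) = u i) ->
  (exists i j, conflict u m i j) ->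
  exists2 d, 0 < d <= n./2 & exists i, conflict u m i (i + d).
Proof.
move=> n_gt0 per [i0 [j0 conf0]].
have {conf0} [i [j [le_ij [eq_win ne]]]] : exists i j, i <= j /\ conflict u m i j.
  have [le_ij|/ltnW le_ji] := leqP i0 j0; first by exists i0, j0.
  exists j0, i0; case: conf0 => eq_win ne; split=> //; split=> [k lt_k|].
    by rewrite eq_win.
  by move/esym.
pose r := (j - i) %% n; have lt_r : r < n by rewrite ltn_mod.
have def_j k : u (j + k) = u (i + r + k).
  have -> : j + k = i + r + k + (j - i) %/ n * n.
    by have := divn_eq (j - i) n; rewrite /r; lia.
  exact: period_mul.
have r_gt0 : 0 < r.
  by rewrite lt0n; apply/eqP => r0; apply: ne; rewrite def_j r0 addn0.
have [le_r|gt_r] := leqP r n./2.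
  exists r; first by rewrite r_gt0.
  exists i; split=> [k lt_k|]; first by rewrite eq_win.
  by rewrite -def_j.
(* When [r] exceeds n/2, the second window comes first, and the first one recurs a period later at
   distance [n - r]. *)
have wrap k : u (i + r + (n - r) + k) = u (i + k).
  by rewrite -(per (i + k)); congr u; lia.
exists (n - r); first by lia.
exists (i + r); split=> [k lt_k|]; first by rewrite wrap -def_j eq_win.
by rewrite wrap -def_j; apply/nesym.
Qed.

Lemma conflict_Bset n c (s : n.-tuple bool) :
  0 < n -> 0 < c <= n./2 + 1 -> aperiodic s ->
  (exists i j, conflict (infrep s) c.-1 i j) ->
  exists k, Bset n c (iter k Lshift s).
Proof.
move=> n_gt0 /andP[c_gt0 le_c] ap_s.
set u := infrep s => conf.
have per : forall i, u (i + n) = u i := infrep_period n s.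
pose Q d := (0 < d <= n./2) && `[< exists i, conflict u c.-1 i (i + d) >].
have exQ : exists d, Q d.
  have [d d_bd conf_d] := conflict_half _ _ _ n_gt0 per conf.
  by exists d; rewrite /Q d_bd; apply/asboolP.
case: (ex_minnP exQ) => d /andP[d_bd /asboolP[i [eq_win ne]]] min_d.
have le_cd : c + d <= n.
  (* Otherwise n = 2d and c = d + 1, and the windows, which cover u_i and
     u_(i+d), close up to a full period. *)
  rewrite leqNgt; apply/negP => gt_cd; apply: ne.
  have -> : i + d + c.-1 = i + n by lia.
  have -> : i + c.-1 = i + d + 0 by lia.
  by rewrite per -eq_win ?addn0 //; lia.
exists i; exists d; first by rewrite /=; lia.
set s' := iter i Lshift s; pose v k := u (i + k).
have nth_s' k : k < n -> nth false s' k = v k.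
  move=> lt_k; rewrite /v /u addnC -infrep_Lshift // /infrep size_tuple.
  by rewrite modn_small.
have v_win k : k < c.-1 -> v k = v (k + d).
  by move=> lt_k; rewrite /v eq_win // addnAC addnA.
have v_ne : v c.-1 <> v (c.-1 + d).
  by rewrite /v [c.-1 + d]addnC addnA.
split; first exact: aperiodic_Lshift.
- apply/aperiodicP; rewrite size_takel ?size_tuple; last by lia.
  move=> p dvd_p lt_pd per_p.
  have p_gt0 : 0 < p by case: p dvd_p {lt_pd per_p}; rewrite // dvd0n; lia.
  have lt_mod k : k %% p < p by rewrite ltn_mod.
  (* Strong induction: an index from [d] on is lowered by [d], a multiple of [p], so the period [p]
     spreads past the prefix. *)
  have v_p k : k < c.-1 + d -> v k = v (k %% p).
    elim/ltn_ind: k => k IHk lt_k; have [lt_kd|le_dk] := ltnP k d.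
      have := per_p k lt_kd; have := lt_mod k => lt_modk.
      by rewrite !nth_take ?nth_s' //; lia.
    rewrite -{1}(subnK le_dk) -v_win; last by lia.
    rewrite IHk; [|lia|lia]; congr v.
    by rewrite -{2}(subnK le_dk) -modnDmr (eqP dvd_p) addn0.
  have v_shift k : k <= c.-1 -> v (d - p + k) = v (k %% p).
    move=> le_k; rewrite v_p; last by lia.
    by rewrite -modnDml (eqP (dvdn_sub dvd_p (dvdnn p))) add0n.
  (* From [d - p] on, [v] repeats its terms 0 to [c.-1], successor included, so the conflict of 0
     and [d] becomes one of [d - p] and [d]. *)
  suff /min_d : Q p by lia.
  rewrite /Q; apply/andP; split; first by lia.
  apply/asboolP; exists (i + (d - p)).
  have shift k : i + (d - p) + p + k = i + (k + d) by lia.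
  split=> [k lt_k|]; rewrite shift -addnA -/(v _) -/(v (_ + d)).
    by rewrite v_shift 1?ltnW // -v_p 1?v_win //; lia.
  by rewrite v_shift // -v_p //; lia.
- by move=> k lt_k; rewrite !nth_s' 1?v_win //; lia.
- have -> : (c + d).-1 = c.-1 + d by lia.
  by rewrite !nth_s' //; lia.
Qed.

Lemma Bset_conflict n c (s : n.-tuple bool) :
  0 < c -> Bset n c s -> exists d, conflict (infrep s) c.-1 0 d.
Proof.
move=> c_gt0 [d /= d_bd [_ _ eq_win ne]]; exists d.
have nth_s k : k < n -> infrep s k = nth false s k.
  by move=> lt_k; rewrite /infrep size_tuple modn_small.
split=> [k lt_k|]; first by rewrite !nth_s 1?[d + k]addnC 1?eq_win //; lia.
have -> : d + c.-1 = (c + d).-1 by lia.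
by rewrite !nth_s //; lia.
Qed.

Theorem theorem1 (n c : nat) (n_ge2 : 2 <= n) (c_ge : up_log 2 n <= c) :
  (forall (w : nat) (s : n.-tuple bool),
     Pset n w (infrep s) -> c <= minn w (n./2 + 1) ->
     exists k : nat, Bset n c (iter k Lshift s)) /\
  (c <= minn (n - 1) (n./2 + 1) ->
     \bigcup_(w in [set w | c <= w <= n - 1]) Pset n w =
     [set infrep (iter k Lshift s) | s in Bset n c & k in [set k | k < n]]).
Proof.
have n_gt0 : 0 < n by lia.
have c_gt0 : 0 < c by apply: leq_trans c_ge; rewrite up_log_gt0.
have partA w (s : n.-tuple bool) : Pset n w (infrep s) ->
    c <= minn w (n./2 + 1) -> exists k : nat, Bset n c (iter k Lshift s).
  move=> [[t /= ap_t /infrep_inj eq_ts] nlc_w]; rewrite leq_min => /andP[le_cw le_cn].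
  rewrite {t}eq_ts in ap_t.
  apply: conflict_Bset; rewrite ?c_gt0 //.
  by apply/(nlc_ge _ _ _ nlc_w); rewrite prednK.
split=> // le_c; apply/seteqP; split=> [u|_ [s Bs [k /= lt_k <-]]].
  move=> [w /= w_bd Pu]; have [[s _ def_u] _] := Pu.
  rewrite -{u}def_u in Pu *; have [|k Bk] := partA _ _ Pu; first by lia.
  (* This rotation undoes the one by [k]; the outer reduction turns [n] into 0 when [n] divides
     [k]. *)
  exists (iter k Lshift s) => //; exists ((n - k %% n) %% n); first exact: ltn_pmod.
  apply/funext => i; rewrite !infrep_Lshift // /infrep size_tuple.
  congr nth; rewrite -[LHS]modnDmr addnAC modnDmr -addnA subnKC ?modnDr //.
  exact/ltnW/ltn_pmod.
have ap_s : aperiodic s by case: Bs => d _ [].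
set t := iter k Lshift s.
have [w le_w nlc_w] := nlc_exists _ _ (FSR_period _ _ n_gt0 (infrep_period n t)).
exists w; last first.
  by split=> //; exists t => //; apply: aperiodic_Lshift.
rewrite /= -subn1 in le_w *; rewrite le_w andbT -(prednK c_gt0).
apply/(nlc_ge _ _ _ nlc_w).
have [d [eq_win ne]] := Bset_conflict _ _ _ c_gt0 Bs.
(* Reading [t] from [n - k] on gives back [s], so the conflict of [s] at 0 and [d] occurs in [t] at
   [n - k] and [d + (n - k)]. *)
have back i : infrep t (i + (n - k)) = infrep s i.
  by rewrite infrep_Lshift // -addnA subnK 1?ltnW // infrep_period.
exists (n - k), (d + (n - k)); split=> [j lt_j|].
  have -> : n - k + j = 0 + j + (n - k) by lia.
  by rewrite (addnAC d) !back eq_win.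
have -> : n - k + c.-1 = 0 + c.-1 + (n - k) by lia.
by rewrite (addnAC d) !back.
Qed.
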